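(* Let $p$ be a prime and let $q$ be an odd prime with $q \neq p$. Define $\delta = \operatorname{ord}_q(p)$ and $\mu = v_q(p^\delta - 1)$ (so $\mu \geq 1$). Let $\phi(z) = z^q$, and let $T_q(z)$ be the $q$-th Chebyshev polynomial. Then for every integer $\nu \geq 0$: $$\lim_{\substack{n \to \infty\\ \delta \mid n\\ v_q(n)=\nu}}\frac{\#\operatorname{Per}\left(\phi, \mathbb{F}_{p^n}\right)}{p^n} = \frac{1}{q^{\mu+\nu}},$$ and $$\lim_{\substack{n \to \infty\\ \delta \mid 2n\\ v_q(n)=\nu}}\frac{\#\operatorname{Per}\left(T_q, \mathbb{F}_{p^n}\right)}{p^n} = \frac{q^{\mu+\nu}+1}{2 q^{\mu+\nu}}.$$
   Context: For a polynomial $\phi$ with coefficients in $\mathbb{Z}$ (reduced mod $p$ when acting on fields of characteristic $p$) and a field $K$, $\operatorname{Per}(\phi,K)=\{\alpha\in K : \phi^m(\alpha)=\alpha \text{ for some } m>0\}$, where $\phi^m$ is the $m$-th iterate of $\phi$ under composition. $\mathbb{F}_{p^n}$ is the field with $p^n$ elements. $v_q(n)$ is the $q$-adic valuation of $n$. $\operatorname{ord}_q(p)$ is the multiplicative order of $p$ modulo $q$, i.e. the smallest positive integer $\delta$ with $q \mid p^\delta-1$. The Chebyshev polynomials $T_d\in\mathbb{Z}[w]$ are defined by $T_0(w)=2$, $T_1(w)=w$, $T_d(w)=wT_{d-1}(w)-T_{d-2}(w)$ for $d\ge 2$; equivalently $T_d$ is the polynomial satisfying $T_d(z+z^{-1})=z^d+z^{-d}$.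 The limits are taken as $n\to\infty$ through the positive integers $n$ satisfying the conditions displayed under the limit sign. *)

(* Defs.v *)
From mathcomp Require Import all_boot all_order all_algebra.
From mathcomp Require Import boolp classical_sets.

Set Implicit Arguments.
Unset Strict Implicit.
Unset Printing Implicit Defensive.

Import Order.TTheory GRing.Theory Num.Theory.

Local Open Scope classical_set_scope.
Local Open Scope ring_scope.

(* Normalized so that T_d(z + 1/z) = z^d + 1/z^d. *)
Fixpoint chebyshev (d : nat) : {poly int} :=
  match d with
  | 0 => 2%:P
  | d1.+1 => match d1 with
             | 0 => 'X
             | d2.+1 => 'X * chebyshev d1 - chebyshev d2
             end
  end.

Definition poly_fun (phi : {poly int}) (K : fieldType) (a : K) : K :=
  (map_poly intr phi).[a].

Definition Per (phi : {poly int}) (K : fieldType) : set K :=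
  [set a : K | exists m : nat, (0 < m)%N /\ iter m (poly_fun phi (K := K)) a = a].
Arguments Per phi K : clear implicits.

(* Meant for a > 0, where the truncated subtraction is exact; the value is then
   0 when a and q are not coprime. *)
Definition mult_ord (q a : nat) : nat :=
  match pselect (exists d : nat, (0 < d)%N && (q %| a ^ d - 1)%N) with
  | left e => ex_minn e
  | right _ => 0%N
  end.

(* Main.v *)
Require Import Defs.
From mathcomp Require Import all_boot all_order all_algebra.
From mathcomp Require Import all_fingroup all_solvable all_field.
From mathcomp Require Import zify ring lra.
From mathcomp Require Import boolp classical_sets reals topology normedtype sequences.

(** Let K be a field with N = p^n elements. The periodic points of z^q in K are
    0 and the elements of K^* of order prime to q, so there are 1 + (N-1)_{q'}
    of them. For T_q one uses the semiconjugacy z |-> z + 1/z from z^q to T_q: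
    in a quadratic extension, every element of K is z + 1/z with z^(N-1) = 1 or
    z^(N+1) = 1, it is periodic exactly when the order of z is prime to q, and
    counting fibres gives 2 #Per = (N-1)_{q'} + (N+1)_{q'}. Lifting the exponent
    gives v_q(N-1) = mu + nu in the first case; in the second case
    v_q(N^2-1) = mu + nu is carried by only one of the factors N-1 and N+1.
    In both cases the ratio #Per / N differs from its limit by at most 1/N. *)

Set Implicit Arguments.
Unset Strict Implicit.
Unset Printing Implicit Defensive.

Import Order.TTheory GRing.Theory Num.Theory.
Import numFieldNormedType.Exports.

(** * Lifting the exponent and the multiplicative order *)

Lemma expn_linear_mod y i : (y.+1 ^ i = 1 + i * y %[mod y ^ 2])%N.
Proof.
elim: i => [|i IHi]; first by rewrite mul0n addn0.
rewrite expnS -modnMmr IHi modnMmr.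
have -> : (y.+1 * (1 + i * y) = i * y ^ 2 + (1 + i.+1 * y))%N by nia.
by rewrite modnMDl.
Qed.

Lemma geom_sum_mod q y m : q %| y -> (\sum_(i < m) y.+1 ^ i = m %[mod q])%N.
Proof.
move=> qy; elim: m => [|m IHm]; first by rewrite big_ord0.
have y1 : y.+1 ^ m = 1 %[mod q].
  by rewrite -modnXm -addn1 -modnDml (eqP qy) add0n modnXm exp1n.
by rewrite big_ord_recr /= -modnDml IHm modnDml -modnDmr y1 modnDmr addn1.
Qed.

(** Since [q ^ 2] divides [y ^ 2], the sum is [q + y * (q * (q - 1) / 2)] modulo [q ^ 2]. As [q] is
    odd, [(q - 1) / 2] is an integer, so [q %| y] makes the second term vanish and leaves [q]. *)
Lemma logn_geom_sum_prime q y :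
  prime q -> odd q -> q %| y -> logn q (\sum_(i < q) y.+1 ^ i) = 1%N.
Proof.
move=> q_pr q_odd qy; set S := (\sum_(i < q) _)%N.
have q_gt1 := prime_gt1 q_pr.
have S_mod : S = q %[mod q ^ 2].
  have -> : S = (\sum_(i < q) (1 + i * y))%N %[mod q ^ 2].
    rewrite /S -modn_summ -[RHS]modn_summ; congr (_ %% _).
    apply: eq_bigr => i _; have/dvdn_exp2r := qy => /(_ 2) q2y2.
    by rewrite -(modn_dvdm _ q2y2) expn_linear_mod modn_dvdm.
  rewrite big_split /= sum_nat_const card_ord muln1 -big_distrl /=.
  rewrite -(big_mkord xpredT (fun i => i)) bin2_sum bin2odd //.
  have /dvdnP[t ->] := qy.
  have -> : (q * q.-1./2 * (t * q) = (q.-1./2 * t) * q ^ 2)%N by lia.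
  by rewrite addnC modnMDl.
have qS : q %| S.
  have qq2 : q %| q ^ 2 by rewrite dvdn_exp.
  by rewrite /dvdn -(modn_dvdm S qq2) S_mod modn_dvdm // modnn.
have q2S : ~~ (q ^ 2 %| S).
  rewrite /dvdn S_mod modn_small ?(ltn_exp2l 1) // -lt0n; exact: ltnW.
have S_gt0 : 0 < S by case: S q2S {S_mod qS} => //; rewrite dvdn0.
apply/eqP; rewrite eqn_leq -[in X in _ && X]pfactor_dvdn // expn1 qS andbT.
by rewrite leqNgt -pfactor_dvdn.
Qed.

(* Lifting the exponent, with x = y + 1. *)
Lemma logn_exp_sub1 q y k : prime q -> odd q -> q %| y -> 0 < y -> 0 < k ->
  logn q (y.+1 ^ k - 1) = (logn q y + logn q k)%N.
Proof.
move=> q_pr q_odd qy y_gt0 k_gt0; have q_gt1 := prime_gt1 q_pr.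
have step x m : 0 < x -> 0 < m ->
    logn q (x.+1 ^ m - 1) = (logn q x + logn q (\sum_(i < m) x.+1 ^ i))%N.
  move=> x0 m0; rewrite subn1 predn_exp lognM //.
  by case: m m0 => // m _; rewrite big_ord_recl /= expn0.
(* Write [k = m * q ^ e] with [q] prime to [m] and induct on [e]. The exponent [m] adds nothing,
   because its geometric sum is [m] modulo [q]; each further factor [q] adds exactly 1. *)
have [m q'm] := pfactor_coprime q_pr k_gt0.
move: (logn q k) => e k_def; rewrite {k}k_def in k_gt0 *.
have m_gt0 : 0 < m by move: k_gt0; rewrite muln_gt0 => /andP[].
elim: e {k_gt0} => [|e IHe].
  rewrite muln1 step // [in X in (_ + X)%N]logn_coprime // prime_coprime //.
  by rewrite /dvdn (geom_sum_mod m qy) -[_ == _]/(q %| m) -prime_coprime.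
rewrite expnSr mulnA expnM.
set x := (y.+1 ^ (m * q ^ e))%N in IHe *.
have x_gt1 : 1 < x.
  by rewrite -(exp1n (m * q ^ e)) ltn_exp2r // muln_gt0 m_gt0 expn_gt0 ltnW.
have qx : q %| x - 1.
  by rewrite subn1 predn_exp dvdn_mulr.
rewrite subn1 in IHe qx.
rewrite -(prednK (ltnW x_gt1)) step //; last 2 first.
- by rewrite -ltnS prednK // ltnW.
- exact: ltnW.
by rewrite logn_geom_sum_prime // IHe /=; lia.
Qed.

(** Fermat's little theorem provides the witness [q.-1], so [mult_ord] takes its minimum branch. It
    also gives [d < q], which later shows that [q] does not divide [d]. *)
Lemma mult_ord_prime p q (d := mult_ord q p) : prime p -> prime q -> q <> p ->
  [/\ 0 < d, q %| p ^ d - 1, d < q & forall k, (d %| k) = (q %| p ^ k - 1)].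
Proof.
move=> p_pr q_pr qp.
have p_gt0 := prime_gt0 p_pr.
have dvdE k : (q %| p ^ k - 1) = (p ^ k == 1 %[mod q]).
  by rewrite eqn_mod_dvd // expn_gt0 p_gt0.
have co_pq : coprime p q.
  by rewrite coprime_sym prime_coprime // dvdn_prime2 //; apply/eqP.
have q1 : 0 < q.-1 by rewrite -ltnS prednK ?prime_gt0 // prime_gt1.
have Fermat : (0 < q.-1) && (q %| p ^ q.-1 - 1).
  by rewrite dvdE -totient_prime // Euler_exp_totient // eqxx andbT totient_prime.
rewrite /d /mult_ord; case: pselect => [ex_d|]; last by case; exists q.-1.
case: ex_minnP => m /andP[m_gt0 qm] min_m; split=> // [|k].
  by rewrite -(prednK (prime_gt0 q_pr)) ltnS min_m.
have pm1 : p ^ m = 1 %[mod q] by apply/eqP; rewrite -dvdE.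
have kE : p ^ k = p ^ (k %% m) %[mod q].
  rewrite {1}(divn_eq k m) expnD mulnC [(_ %/ _ * _)%N]mulnC expnM -modnMmr.
  by rewrite -modnXm pm1 modnXm exp1n modnMmr muln1.
(* The remainder of [k] modulo [m] passes the same test as [k], so by minimality of [m] it can only
   pass when it is 0. *)
rewrite dvdE kE -dvdE -[m %| k]/(_ == 0); case: posnP => [->|r_gt0].
  by rewrite expn0 subnn dvdn0.
apply/esym/negP => qr; have := min_m (k %% m); rewrite r_gt0 qr => /(_ isT).
by rewrite leqNgt ltn_mod m_gt0.
Qed.

(** Lifting the exponent is applied to the base [p ^ d] and the exponent [j = k / d]; [j] and [k]
    have the same [q]-adic valuation because [0 < d < q]. *)
Lemma logn_exp_mult_ord p q k : prime p -> prime q -> odd q -> q <> p ->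
  0 < k -> mult_ord q p %| k ->
  logn q (p ^ k - 1) = (logn q (p ^ mult_ord q p - 1) + logn q k)%N.
Proof.
move=> p_pr q_pr q_odd qp k_gt0.
have [] := mult_ord_prime p_pr q_pr qp; move: (mult_ord q p) => d d_gt0 qd ltdq _.
move=> /dvdnP[j k_jd]; have j_gt0 : 0 < j by case: j k_jd k_gt0 => [->|].
have pd_gt1 : 1 < p ^ d.
  by rewrite -(exp1n d) ltn_exp2r // prime_gt1.
rewrite k_jd lognM // [logn q d]logn_coprime ?addn0; last first.
  by rewrite prime_coprime // gtnNdvd.
rewrite mulnC expnM -{1}(prednK (ltnW pd_gt1)) logn_exp_sub1 // -?subn1 //.
by rewrite subn_gt0.
Qed.

(** * Roots of unity of order prime to q *)

Local Open Scope ring_scope.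

Lemma card_unity_roots (E : finFieldType) n a (w : E) :
  n.-primitive_root w -> (a %| n)%N -> #|[pred z : E | z ^+ a == 1]| = a.
Proof.
move=> prim_w a_n; have a_gt0 := dvdn_gt0 (prim_order_gt0 prim_w) a_n.
have prim_v := dvdn_prim_root prim_w a_n; set v := w ^+ _ in prim_v.
apply/eqP; rewrite eqn_leq; apply/andP; split.
  rewrite cardE; apply: max_unity_roots (enum_uniq _) => //.
  by apply/allP => z; rewrite mem_enum unity_rootE.
rewrite -{1}[a]card_ord -(card_image (f := fun i : 'I_a => v ^+ i)); last first.
  move=> i j /eqP; rewrite (eq_prim_root_expr prim_v) !modn_small // => /eqP.
  exact: val_inj.
apply: subset_leq_card; apply/fintype.subsetP => _ /fintype.imageP[i _ ->].
by rewrite inE exprAC (prim_expr_order prim_v) expr1n.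
Qed.

Lemma expr_gcd_eq1 (E : fieldType) (z : E) a b : (0 < a)%N ->
  z ^+ a = 1 -> z ^+ b = 1 -> z ^+ gcdn a b = 1.
Proof.
move=> a0 za zb; have [m prim_z m_a] := prim_order_exists a0 za.
have m_b : (m %| b)%N by rewrite (prim_order_dvd prim_z) zb.
by apply/eqP; rewrite -(prim_order_dvd prim_z) dvdn_gcd m_a.
Qed.

(** The order of [z] divides [gcdn n c], a divisor of [n] that is prime to [q], hence a divisor of
    the [q']-part of [n]. With [c = q ^ m - 1] this turns periodicity into a root of unity
    condition. *)
Lemma expr_part_eq1 (E : fieldType) (z : E) q n c : prime q -> (0 < n)%N ->
  coprime q c -> z ^+ n = 1 -> z ^+ c = 1 -> z ^+ (n`_q^')%N = 1.
Proof.
move=> q_pr n0 co_qc zn zc; have := expr_gcd_eq1 n0 zn zc.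
have g_n := dvdn_gcdl n c; have g_c := dvdn_gcdr n c.
move: (gcdn n c) => g in g_n g_c * => zg.
have: (g %| n`_q^')%N.
  rewrite -(@Gauss_dvdr _ n`_q) ?partnC // p_part coprime_sym.
  by apply: coprimeXl; apply: coprime_dvdr co_qc.
by case/dvdnP => k ->; rewrite mulnC exprM zg expr1n.
Qed.

(** The converse direction: by Euler, [q ^ totient a] is 1 modulo [a], so a root of unity of order
    prime to [q] is periodic. *)
Lemma exists_expr_qX_id (E : fieldType) (z : E) q a : (0 < a)%N -> coprime q a ->
  z ^+ a = 1 -> exists2 m, (0 < m)%N & z ^+ (q ^ m) = z.
Proof.
move=> a0 co_qa za; exists (totient a); first by rewrite totient_gt0.
rewrite -(expr_mod _ za) Euler_exp_totient // (expr_mod _ za).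
exact: expr1.
Qed.

Lemma coprime_partC' q n : prime q -> coprime q n`_q^'.
Proof. by move=> /pnat_id q_q; apply: pnat_coprime q_q (part_pnat _ _). Qed.

Lemma finField_prim_root (K : finFieldType) : exists w : K, #|K|.-1.-primitive_root w.
Proof.
have K_gt1 := finNzRing_gt1 K.
have: has #|K|.-1.-primitive_root (enum [pred x : K | x != 0]).
  apply: has_prim_root (enum_uniq _) _; first by rewrite -ltnS prednK // ltnW.
    apply/allP => x; rewrite mem_enum inE unity_rootE => x0.
    apply/eqP/(mulfI x0); rewrite -exprS prednK ?expf_card ?mulr1 //.
    exact: ltnW.
  by rewrite -cardE -(cardC1 (0 : K)) (eq_card (B := predC1 0)).
by case/hasP => w _; exists w.
Qed.

(** * Periodic points of the power map *)

Lemma iter_poly_fun_Xn (K : fieldType) q m (a : K) :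
  iter m (@poly_fun 'X^q K) a = a ^+ (q ^ m).
Proof.
elim: m => [|m IHm]; first by rewrite expr1.
by rewrite iterS IHm /poly_fun map_polyXn hornerXn -exprM -expnSr.
Qed.

Lemma card_Per_Xn (K : finFieldType) q : prime q ->
  #|Per 'X^q K| = (#|K|.-1`_q^').+1%N.
Proof.
move=> q_pr; have K_gt1 := finNzRing_gt1 K.
have [w prim_w] := finField_prim_root K.
have N_gt0 := prim_order_gt0 prim_w; have q_gt0 := prime_gt0 q_pr.
set a := (_.-1`_q^')%N; have a_gt0 : (0 < a)%N by apply: part_gt0.
have co_qa : coprime q a by apply: coprime_partC'.
(* The successor accounts for the periodic point 0, which is not a root of unity; the rest is a
   group of roots of unity. *)
rewrite -[in RHS](card_unity_roots prim_w (dvdn_part (q^')%N _) : _ = a) -add1n.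
rewrite -(card1 (0 : K)) -cardUI [X in (_ + X)%N]eq_card0 ?addn0; last first.
  move=> x; rewrite !inE; apply/negP => /andP[/eqP-> /eqP].
  by rewrite expr0n eqn0Ngt a_gt0 => /eqP; rewrite eq_sym oner_eq0.
apply: eq_card => x; rewrite !inE; apply/idP/idP; last first.
  case/orP => [/eqP->|/eqP xa]; apply/asboolP.
    by exists 1%N; rewrite iter_poly_fun_Xn expr0n eqn0Ngt expn_gt0 q_gt0.
  have [m m_gt0 xm] := exists_expr_qX_id a_gt0 co_qa xa.
  by exists m; rewrite iter_poly_fun_Xn.
case/asboolP => m [m_gt0]; rewrite iter_poly_fun_Xn.
have [//|x0 xm] := eqVneq x 0.
have qm_gt0 : (0 < q ^ m)%N by rewrite expn_gt0 q_gt0.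
apply/eqP; apply: (@expr_part_eq1 _ _ _ _ (q ^ m).-1) => //.
- by rewrite -(coprime_pexpl _ _ m_gt0) coprimenP.
- by apply: (mulfI x0); rewrite -exprS prednK ?expf_card ?mulr1 // ltnW.
- by apply: (mulfI x0); rewrite -exprS prednK // mulr1.
Qed.

(** * Passage to an extension field *)

Lemma iter_poly_fun_rmorph (K E : fieldType) (f : {rmorphism K -> E}) phi m a :
  iter m (@poly_fun phi E) (f a) = f (iter m (@poly_fun phi K) a).
Proof.
elim: m => //= m ->; rewrite /poly_fun -horner_map -map_poly_comp.
by congr (_).[_]; apply: eq_map_poly => k /=; rewrite rmorph_int.
Qed.

Lemma natr_finField_card (K : finFieldType) : #|K|%:R = 0 :> K.
Proof.
by rewrite -FinRing.zmodXgE -cardsT expg_cardG ?inE.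
Qed.

(** Take a splitting field of [X^M - 1] with [M = N^2 - 1]. As [N = 0] in it, [M = -1] is nonzero
    there, so the polynomial is separable and its [M] distinct roots include a primitive one. This
    root provides all roots of unity of order dividing [N - 1] or [N + 1]. *)
Lemma finField_quadratic_ext (K : finFieldType) :
  exists (E : finFieldType) (f : {rmorphism K -> E}) (w : E),
    (#|K| ^ 2).-1.-primitive_root w.
Proof.
have K_gt1 := finNzRing_gt1 K; set M := (_ ^ 2).-1.
have M_gt0 : (0 < M)%N by rewrite -ltnS prednK ?expn_gt0 ?(ltnW K_gt1) // (ltn_exp2l 0).
have q_nz : 'X^M - 1 != 0 :> {poly K}.
  by rewrite -size_poly_gt0 size_XnsubC.
have [/= L [zs Dp _]] := FinSplittingFieldFor q_nz.
rewrite rmorphB rmorphXn /= map_polyX rmorph1 in Dp.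
have Uzs : uniq zs.
  rewrite -separable_prod_XsubC -(eqp_separable Dp).
  rewrite cyclotomic.separable_Xn_sub_1 //.
  have N0 : #|K|%:R = 0 :> L.
    by rewrite -(rmorph_nat (in_alg L)) natr_finField_card rmorph0.
  rewrite /M -subn1 natrB ?expn_gt0 ?(ltnW K_gt1) //.
  by rewrite natrX N0 expr0n sub0r oppr_eq0 oner_eq0.
have zsM : size zs = M.
  by have := eqp_size Dp; rewrite size_prod_XsubC size_XnsubC // => -[].
exists (FinFieldExtType L), (in_alg L).
have: has M.-primitive_root zs.
  apply: has_prim_root; rewrite ?zsM //.
  apply/allP => z zs_z; rewrite /root_of_unity (eqp_root Dp).
  by rewrite root_prod_XsubC.
by case/hasP => w _; exists w.
Qed.

(** * The semiconjugacy z + 1/z and its fibres *)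

Definition joukowski (E : fieldType) (z : E) : E := z + z^-1.

Lemma poly_fun_chebyshev (E : fieldType) d (z : E) : z != 0 ->
  @poly_fun (chebyshev d) E (joukowski z) = joukowski (z ^+ d).
Proof.
(* The Chebyshev recurrence has two steps, so the induction carries two consecutive degrees. *)
move=> z0; suff [] : @poly_fun (chebyshev d) E (joukowski z) = joukowski (z ^+ d)
  /\ @poly_fun (chebyshev d.+1) E (joukowski z) = joukowski (z ^+ d.+1) by [].
elim: d => [|d [IHd IHd1]].
  rewrite /poly_fun /= map_polyC map_polyX hornerC hornerX /joukowski invr1.
  by split.
split=> //; move: IHd IHd1; rewrite /poly_fun /joukowski => IHd IHd1.
rewrite [chebyshev d.+2]/= rmorphB rmorphM /= map_polyX hornerD hornerN hornerM.
rewrite hornerX IHd IHd1 !exprS.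
have zd : z ^+ d != 0 by apply: expf_neq0.
by field; rewrite z0 zd.
Qed.

Lemma iter_poly_fun_chebyshev (E : fieldType) q m (z : E) : z != 0 ->
  iter m (@poly_fun (chebyshev q) E) (joukowski z) =
    joukowski (z ^+ (q ^ m)).
Proof.
move=> z0; elim: m => [|m IHm]; first by rewrite expr1.
by rewrite iterS IHm poly_fun_chebyshev ?expf_neq0 // -exprM -expnSr.
Qed.

Lemma joukowski_eq (E : fieldType) (y z : E) : y != 0 -> z != 0 ->
  (joukowski y == joukowski z) = (y == z) || (y == z^-1).
Proof.
move=> y0 z0; rewrite -subr_eq0 /joukowski.
have -> : y + y^-1 - (z + z^-1) = (y - z) * (y - z^-1) / y.
  by field; rewrite y0 z0.
by rewrite !mulf_eq0 invr_eq0 (negPf y0) orbF !subr_eq0.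
Qed.

Lemma expr_eq1_neq0 (E : fieldType) (z : E) n : (0 < n)%N -> z ^+ n = 1 -> z != 0.
Proof.
move=> n0 zn; apply/negP => /eqP z0; move: zn; rewrite z0 expr0n eqn0Ngt n0.
by move/eqP; rewrite eq_sym oner_eq0.
Qed.

(* The fibres of z |-> z + 1/z are the {z, 1/z}. Such a fibre lies in exactly
   one of the two groups of roots of unity, unless z = 1/z, and then it has one
   element and lies in both. *)
Lemma card_joukowski_unity_roots (E : finFieldType) a b (w : E) M :
  M.-primitive_root w -> (a %| M)%N -> (b %| M)%N ->
  (forall z : E, (z ^+ a == 1) && (z ^+ b == 1) = (z ^+ 2 == 1)) ->
  #|[pred x : E | [exists z : E,
       ((z ^+ a == 1) || (z ^+ b == 1)) && (x == joukowski z)]]|.*2 = (a + b)%N.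
Proof.
move=> prim_w a_M b_M abE; have M_gt0 := prim_order_gt0 prim_w.
set W := [pred x : E | _].
have a_gt0 := dvdn_gt0 M_gt0 a_M; have b_gt0 := dvdn_gt0 M_gt0 b_M.
have VX n (z : E) : (z^-1 ^+ n == 1) = (z ^+ n == 1).
  by rewrite exprVn invr_eq1.
pose U c := [pred z : E | z ^+ c == 1].
(* Both [a] and [b] are split into counts over the fibres above [W]; it then remains to see that
   each fibre contributes 2 to their sum. *)
have part c : {in U c, forall z, joukowski z \in W} -> (c %| M)%N ->
    c = (\sum_(x in W) \sum_(z | U c z && (joukowski z == x)) 1)%N.
  move=> cW c_M; rewrite -[LHS](card_unity_roots prim_w c_M) -sum1_card.
  by rewrite (partition_big (@joukowski E) (mem W)) //=; exact: cW.
have aW : {in U a, forall z, joukowski z \in W}.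
  by move=> z za; apply/existsP; exists z; rewrite [_ == 1]za eqxx.
have bW : {in U b, forall z, joukowski z \in W}.
  by move=> z zb; apply/existsP; exists z; rewrite [z ^+ b == 1]zb orbT eqxx.
apply: etrans (congr2 addn (esym (part a aW a_M)) (esym (part b bW b_M))).
rewrite -muln2 -sum_nat_const -big_split /=; apply: eq_bigr => x.
case/existsP => z /andP[z_ab /eqP->].
have z0 : z != 0.
  by case/orP: z_ab => /eqP; apply: expr_eq1_neq0.
have fibre c : (0 < c)%N -> (\sum_(y | U c y && (joukowski y == joukowski z)) 1
    = U c z * #|[set z; z^-1]%SET|)%N.
  move=> c_gt0; have U0 y : U c y -> y != 0 by move=> /eqP; apply: expr_eq1_neq0.
  have [zc|zc] := boolP (U c z); last first.
    rewrite mul0n big_pred0 // => y; apply/negP => /andP[yc].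
    rewrite joukowski_eq ?(U0 y) // => /orP[]/eqP yz; move: yc zc; rewrite yz /= ?VX.
      by move->.
    by move->.
  rewrite mul1n -sum1_card; apply: eq_bigl => y; rewrite !inE.
  have [yc|yc] := boolP (y ^+ c == 1); first by rewrite joukowski_eq ?(U0 y yc).
  apply/esym/negP => /orP[]/eqP yz; move: yc zc; rewrite yz /= ?VX.
    by move=> /negP.
  by move=> /negP.
have := fibre a a_gt0; have := fibre b b_gt0; rewrite /= => -> ->.
rewrite cards2 -mulnDl.
have -> : (z != z^-1) = (z ^+ 2 != 1).
  by rewrite -(inj_eq (mulfI z0)) divff // -expr2.
rewrite -abE; move: z_ab.
by case: (z ^+ a == 1); case: (z ^+ b == 1).
Qed.

Lemma odd_partC' q n : prime q -> odd q -> (0 < n)%N -> odd (n`_q^')%N = odd n.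
Proof.
move=> q_pr q_odd n_gt0; rewrite -[in RHS](partnC q n_gt0) oddM p_part oddX.
by rewrite q_odd orbT.
Qed.

(** A common root has order dividing [(N + 1) - (N - 1) = 2]. Conversely, -1 is a common root
    because both exponents are even when [N] is odd, and -1 = 1 when [N] is even. The parity
    hypotheses cover both the full exponents and their [q']-parts. *)
Lemma unity_root2_pred_succ (K E : finFieldType) (f : {rmorphism K -> E}) a b :
  (a %| #|K|.-1)%N -> (b %| #|K|.+1)%N ->
  odd a = odd #|K|.-1 -> odd b = odd #|K|.+1 ->
  forall z : E, (z ^+ a == 1) && (z ^+ b == 1) = (z ^+ 2 == 1).
Proof.
have N_gt0 := ltnW (finNzRing_gt1 K).
move=> a_N b_N a_odd b_odd z; apply/andP/idP => [[/eqP za /eqP zb]|].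
  have zN1 : z ^+ #|K|.-1 = 1 by case/dvdnP: a_N => k ->; rewrite mulnC exprM za expr1n.
  have : z ^+ #|K|.+1 = 1 by case/dvdnP: b_N => k ->; rewrite mulnC exprM zb expr1n.
  by rewrite -(prednK N_gt0) -addn2 exprD zN1 mul1r => ->.
rewrite sqrf_eq1 => /orP[]/eqP->; first by rewrite !expr1n.
rewrite -[(-1) ^+ a]signr_odd -[(-1) ^+ b]signr_odd a_odd b_odd /=.
have [N_odd|N_even] := boolP (odd #|K|).
  rewrite -{1}(prednK N_gt0) /= in N_odd.
  by rewrite (negPf N_odd) /= expr0.
have -> : -1 = 1 :> E.
  rewrite -(rmorph1 f) -rmorphN -(expf_card (-1)) -signr_odd (negPf N_even).
  by rewrite expr0.
by rewrite !expr1n.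
Qed.

Lemma card_subpred_eqi (T : finType) (A B : pred T) n :
  {subset A <= B} -> #|A| = n -> (#|B| <= n)%N -> A =i B.
Proof.
move=> sAB An leBn; apply/subset_cardP; last exact/fintype.subsetP.
apply/eqP; rewrite eqn_leq {2}An leBn andbT.
by apply: subset_leq_card; apply/fintype.subsetP.
Qed.

(** * Periodic points of the Chebyshev polynomial *)

Section QuadraticExtension.
Variables (K E : finFieldType) (f : {rmorphism K -> E}) (w : E).
Local Notation N := #|K|.
Hypothesis prim_w : (N ^ 2).-1.-primitive_root w.

Let N_gt1 : (1 < N)%N := finNzRing_gt1 K.

Let predn_sqr : ((N ^ 2).-1 = N.-1 * N.+1)%N.
Proof. by rewrite -subn1 -[X in (_ - X)%N](exp1n 2) subn_sqr subn1 addn1. Qed.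

Lemma card_expr_finField_id : (#|[pred x : E | x ^+ N == x]| <= N)%N.
Proof.
have szp : size ('X^N - 'X : {poly E}) = N.+1.
  by rewrite size_polyDl size_polyXn // size_polyN size_polyX.
have p0 : 'X^N - 'X != 0 :> {poly E} by rewrite -size_poly_gt0 szp.
rewrite -ltnS -szp cardE; apply: max_poly_roots (enum_uniq _) => //.
apply/allP => x; rewrite mem_enum inE => /eqP xN.
by rewrite rootE !hornerE xN subrr.
Qed.

Lemma in_codom_finFieldE : codom f =i [pred x : E | x ^+ N == x].
Proof.
apply: card_subpred_eqi card_expr_finField_id.
  by move=> _ /codomP[x ->]; rewrite inE -rmorphXn expf_card.
by rewrite card_codom //; exact: fmorph_inj.
Qed.

Let joukowski_roots a b := [pred x : E | [exists z : E,
  ((z ^+ a == 1) || (z ^+ b == 1)) && (x == joukowski z)]].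

Let card_joukowski_roots a b : (a %| N.-1)%N -> (b %| N.+1)%N ->
  odd a = odd N.-1 -> odd b = odd N.+1 -> #|joukowski_roots a b|.*2 = (a + b)%N.
Proof.
move=> a_N b_N a_odd b_odd.
apply: (card_joukowski_unity_roots prim_w).
- by rewrite predn_sqr dvdn_mulr.
- by rewrite predn_sqr dvdn_mull.
- exact: (unity_root2_pred_succ f).
Qed.

Variables (p n : nat).
Hypotheses (p_pr : prime p) (cardK : N = (p ^ n)%N).

(** The map [x |-> x ^ N] is additive, [N] being a power of the characteristic, and it sends [z] to
    [z] or to [z^-1]; either way [z + z^-1] is fixed. *)
Lemma joukowski_expr_id (z : E) : (z ^+ N.-1 == 1) || (z ^+ N.+1 == 1) ->
  joukowski z ^+ N = joukowski z.
Proof.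
have pE : p \in [pchar E] by rewrite (fmorph_pchar f) (card_finPcharP cardK).
have Nnat : p.-nat N by rewrite cardK pnatX pnat_id.
move=> zN; have z0 : z != 0.
  by case/orP: zN => /eqP; apply: expr_eq1_neq0; rewrite // -ltnS prednK // ltnW.
rewrite /joukowski exprDn_pchar ?(eq_pnat _ (pcharf_eq pE)) // exprVn.
case/orP: zN => /eqP zN.
  by rewrite -(prednK (ltnW N_gt1)) exprS zN mulr1.
suff -> : z ^+ N = z^-1 by rewrite invrK addrC.
by apply: (mulfI z0); rewrite -exprS zN divff.
Qed.

(** Counting replaces solving a quadratic equation: the two groups have
    [((N - 1) + (N + 1)) / 2 = N] images, all fixed by [x |-> x ^ N], which fixes at most [N]
    elements. *)
Lemma expr_id_joukowski (x : E) : x ^+ N = x ->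
  exists2 z, x = joukowski z & z ^+ N.-1 = 1 \/ z ^+ N.+1 = 1.
Proof.
move=> xN; have cardW : #|joukowski_roots N.-1 N.+1| = N.
  apply: double_inj; rewrite card_joukowski_roots // -addnn.
  by rewrite -{1 3}(prednK (ltnW N_gt1)) addnS.
have sW : {subset joukowski_roots N.-1 N.+1 <= [pred y : E | y ^+ N == y]}.
  by move=> _ /existsP[z /andP[zN /eqP->]]; rewrite inE joukowski_expr_id.
have := card_subpred_eqi sW cardW card_expr_finField_id x.
rewrite !inE xN eqxx => /existsP[z /andP[/orP zN /eqP->]].
by exists z => //; case: zN => /eqP; [left | right].
Qed.

Lemma card_Per_chebyshev_ext q : prime q -> odd q ->
  (#|Per (chebyshev q) K|.*2 = N.-1`_q^' + N.+1`_q^')%N.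
Proof.
move=> q_pr q_odd; have N1_gt0 : (0 < N.-1)%N by rewrite -ltnS prednK // ltnW.
set a := (N.-1`_q^')%N; set b := (N.+1`_q^')%N.
have a_N : (a %| N.-1)%N by apply: dvdn_part.
have b_N : (b %| N.+1)%N by apply: dvdn_part.
rewrite -(card_joukowski_roots a_N b_N) ?odd_partC' //; congr _.*2.
rewrite -(card_image (fmorph_inj f)); apply: eq_card => x.
apply/fintype.imageP/existsP => [[y]|[z /andP[zab /eqP->{x}]]].
  move=> /set_mem[m [m_gt0 ym]] ->{x}.
  have fyN : f y ^+ N = f y by rewrite -rmorphXn expf_card.
  have := iter_poly_fun_rmorph f (chebyshev q) m y; rewrite ym.
  have [z -> zN] := expr_id_joukowski fyN.
  have z0 : z != 0 by case: zN; apply: expr_eq1_neq0.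
  rewrite iter_poly_fun_chebyshev // => /eqP.
  rewrite joukowski_eq ?expf_neq0 // => zm.
  (* Periodicity of [z + z^-1] only gives [z ^+ (q ^ m) = z] or [z^-1]; doubling the period removes
     the inverse. *)
  have z2m : z ^+ (q ^ (m + m)) = z.
    rewrite expnD exprM; case/orP: zm => /eqP zm; first by rewrite zm.
    by rewrite zm exprVn zm invrK.
  have q2m_gt0 : (0 < q ^ (m + m))%N by rewrite expn_gt0 prime_gt0.
  have zc : z ^+ (q ^ (m + m)).-1 = 1.
    by apply: (mulfI z0); rewrite -exprS prednK // mulr1.
  have co_qc : coprime q (q ^ (m + m)).-1.
    by rewrite -(@coprime_pexpl (m + m)) ?coprimenP // addn_gt0 m_gt0.
  exists z; rewrite eqxx andbT; apply/orP.
  by case: zN => zN; [left | right]; apply/eqP; apply: expr_part_eq1 zN zc.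
have zN : (z ^+ N.-1 == 1) || (z ^+ N.+1 == 1).
  case/orP: zab => /eqP zc; apply/orP; [left | right]; apply/eqP.
    by case/dvdnP: a_N => k ->; rewrite mulnC exprM zc expr1n.
  by case/dvdnP: b_N => k ->; rewrite mulnC exprM zc expr1n.
have [m m_gt0 zm] : exists2 m, (0 < m)%N & z ^+ (q ^ m) = z.
  by case/orP: zab => /eqP; apply: exists_expr_qX_id; rewrite ?part_gt0 ?coprime_partC'.
have z0 : z != 0 by case/orP: zN => /eqP; apply: expr_eq1_neq0.
(* Being fixed by [x |-> x ^ N], the point descends to [K], and injectivity of [f] brings its
   periodicity along. *)
have: joukowski z \in codom f by rewrite in_codom_finFieldE inE joukowski_expr_id.
case/codomP => y zy; exists y => //; apply: mem_set; exists m.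
split=> //; apply: (fmorph_inj f); rewrite -iter_poly_fun_rmorph -zy.
by rewrite iter_poly_fun_chebyshev // zm.
Qed.

End QuadraticExtension.

Lemma card_Per_chebyshev (K : finFieldType) p n q : prime p -> #|K| = (p ^ n)%N ->
  prime q -> odd q ->
  (#|Per (chebyshev q) K|.*2 = #|K|.-1`_q^' + #|K|.+1`_q^')%N.
Proof.
move=> p_pr cardK; have [E [f [w prim_w]]] := finField_quadratic_ext K.
exact: (card_Per_chebyshev_ext f prim_w p_pr cardK).
Qed.

(** * The limits *)

Local Open Scope classical_set_scope.
Local Open Scope ring_scope.

Lemma cvg_within_geometric (R : realType) (u : nat -> R) (D : set nat) (l : R) p :
  (1 < p)%N -> (forall n, D n -> `|l - u n| <= (p%:R ^+ n)^-1) ->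
  u n @[n --> within D \oo] --> l.
Proof.
move=> p_gt1 ul; apply/cvgrPdist_le => e e_gt0; rewrite near_withinE.
have p1 : `|p%:R^-1 : R| < 1.
  rewrite ger0_norm ?invr_ge0 ?ler0n // invf_lt1 ?ltr1n //.
  by rewrite ltr0n ltnW.
have /cvgrPdist_le/(_ e e_gt0) := cvg_expr p1.
apply: filterS => n; rewrite sub0r normrN => pe Dn; apply: le_trans (ul n Dn) _.
by apply: le_trans pe; rewrite exprVn ler_norm.
Qed.

Lemma partC'_mul_exp (q n : nat) : (0 < n)%N -> (n`_q^' * q ^ logn q n = n)%N.
Proof. by move=> n_gt0; rewrite mulnC -p_part partnC. Qed.

(* As q is odd, it divides at most one of N - 1 and N + 1. *)
Lemma logn_pred_succ q N : prime q -> odd q -> (1 < N)%N ->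
  (logn q N.-1, logn q N.+1) \in
    [:: (logn q (N ^ 2 - 1), 0%N); (0%N, logn q (N ^ 2 - 1))].
Proof.
move=> q_pr q_odd N_gt1; have q_gt1 := prime_gt1 q_pr.
rewrite -[X in (_ - X)%N](exp1n 2) subn_sqr subn1 addn1 lognM //; last first.
  by case: N N_gt1 => [|[]].
have [qN|q'N] := boolP (q %| N.-1)%N; last first.
  have -> : logn q N.-1 = 0%N by rewrite logn_coprime // prime_coprime.
  by rewrite add0n inE [in X in _ || X]inE eqxx orbT.
suff -> : logn q N.+1 = 0%N by rewrite addn0 inE eqxx.
rewrite logn_coprime // prime_coprime //; apply/negP => qN1.
have : (q %| 2)%N by rewrite -(dvdn_addr 2 qN) addn2 prednK // ltnW.
by rewrite dvdn_prime2 // => /eqP q2; rewrite q2 in q_odd.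
Qed.

(** Each difference between limit and ratio is brought to the form [t / (Q * N)] with
    [Q = q ^ (mu + nu)] and [N = p ^ n]. *)
Lemma normr_div_mul_le (R : realFieldType) (t Q N : R) :
  0 < Q -> 0 < N -> `|t| <= Q -> `|t / (Q * N)| <= N^-1.
Proof.
move=> Q_gt0 N_gt0 tQ; rewrite normrM normfV [`|Q * N|]gtr0_norm ?mulr_gt0 //.
by rewrite ler_pdivrMr ?mulr_gt0 // mulrCA mulVf ?mulr1 // lt0r_neq0.
Qed.

Theorem mainTheorem1 (R : realType) (p q : nat)
    (hp : prime p) (hq : prime q) (hqodd : odd q) (hqp : q <> p)
    (F : nat -> finFieldType) (hF : forall n : nat, (0 < n)%N -> #|F n| = (p ^ n)%N)
    (delta mu : nat) (hdelta : delta = mult_ord q p)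
    (hmu : mu = logn q (p ^ delta - 1)) (nu : nat) :
  ((#|Per 'X^q (F n)|%:R / p%:R ^+ n : R)
     @[n --> within [set n : nat | [/\ (0 < n)%N, (delta %| n)%N & logn q n = nu]] \oo]
     --> (1 / q%:R ^+ (mu + nu) : R))
  /\
  ((#|Per (chebyshev q) (F n)|%:R / p%:R ^+ n : R)
     @[n --> within [set n : nat | [/\ (0 < n)%N, (delta %| 2 * n)%N & logn q n = nu]] \oo]
     --> ((q%:R ^+ (mu + nu) + 1) / (2 * q%:R ^+ (mu + nu)) : R)).
Proof.
have p_gt1 := prime_gt1 hp.
have logE k : (0 < k)%N -> (delta %| k)%N -> logn q (p ^ k - 1) = (mu + logn q k)%N.
  by move=> k0; rewrite hmu hdelta; apply: logn_exp_mult_ord.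
set Q : R := q%:R ^+ (mu + nu).
have Q_ge1 : 1 <= Q by rewrite exprn_ege1 // ler1n prime_gt0.
have Q_gt0 : 0 < Q by apply: lt_le_trans Q_ge1.
have N_gt1 n : (0 < n)%N -> (1 < p ^ n)%N by move=> n0; rewrite -(expn0 p) ltn_exp2l.
split; apply: (cvg_within_geometric p_gt1) => n /= [n_gt0 dn nun].
  have Ngt1 := N_gt1 n n_gt0.
  rewrite card_Per_Xn // hF //; have := @partC'_mul_exp q (p ^ n).-1.
  rewrite -subn1 subn_gt0 => /(_ Ngt1); rewrite logE // nun.
  set a := (_`_q^')%N => aQ.
  (* All of the [q]-part of [N - 1] is [Q], so [N = a * Q + 1], while the number of periodic points
     is [a + 1]. *)
  have {}aQ : p%:R ^+ n = a%:R * Q + 1 :> R.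
    by rewrite /Q -!natrX -natrM aQ natr1 -addn1 subnK // ltnW.
  have N_gt0 : 0 < p%:R ^+ n :> R by rewrite exprn_gt0 // ltr0n ltnW.
  rewrite -[a.+1%:R]natr1; move: N_gt0 aQ.
  move: (p%:R ^+ n) (a%:R) => N x N_gt0 NE.
  have -> : 1 / Q - (x + 1) / N = (1 - Q) / (Q * N).
    by rewrite NE in N_gt0 *; field; rewrite !lt0r_neq0.
  by apply: normr_div_mul_le; rewrite // ler0_norm; lra.
have Ngt1 := N_gt1 n n_gt0; have N_gt0 := ltnW Ngt1.
have card_Per := card_Per_chebyshev hp (hF n n_gt0) hq hqodd.
(* Here [delta] divides only [2 * n], so the valuation is computed for [p ^ (2 * n) - 1]; the factor
   2 adds nothing since [q] is odd. *)
have logN2 : logn q ((p ^ n) ^ 2 - 1) = (mu + nu)%N.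
  rewrite -expnM mulnC logE ?muln_gt0 // lognM // nun.
  rewrite [logn q 2]logn_coprime // prime_coprime // dvdn_prime2 //.
  by apply/eqP => q2; rewrite q2 in hqodd.
have := logn_pred_succ hq hqodd Ngt1; rewrite {}logN2.
have N1_gt0 : (0 < (p ^ n).-1)%N by rewrite -ltnS prednK.
have := @partC'_mul_exp q (p ^ n).+1 isT; have := @partC'_mul_exp q _ N1_gt0.
rewrite hF // in card_Per; move: card_Per.
move: ((p ^ n).-1`_q^')%N ((p ^ n).+1`_q^')%N => a b ab aE bE logq.
have {}ab : (#|Per (chebyshev q) (F n)|%:R = (a%:R + b%:R) / 2 :> R).
  by rewrite -natrD -ab -muln2 natrM mulfK // pnatr_eq0.
have {}aE : a%:R * q%:R ^+ logn q (p ^ n).-1 = p%:R ^+ n - 1 :> R.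
  by rewrite -!natrX -natrM aE -subn1 natrB.
have {}bE : b%:R * q%:R ^+ logn q (p ^ n).+1 = p%:R ^+ n + 1 :> R.
  by rewrite -!natrX -natrM bE natr1.
have {}N_gt0 : 0 < p%:R ^+ n :> R by rewrite exprn_gt0 // ltr0n ltnW.
rewrite {}ab; move: logq aE bE N_gt0; move: (p%:R ^+ n) (a%:R) (b%:R) => N x y.
(* Either [x = (N - 1) / Q] and [y = N + 1], or [x = N - 1] and [y = (N + 1) / Q]. The two errors
   differ only in sign, so the limit is the same. *)
rewrite !inE => /orP[]/eqP[-> ->]; rewrite -/Q expr0 mulr1 => xE yE N_gt0.
  have -> : (Q + 1) / (2 * Q) - (x + y) / 2 / N = (1 - Q) / 2 / (Q * N).
    have -> : x = (N - 1) / Q by rewrite -xE mulfK // lt0r_neq0.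
    by rewrite -[y]mulr1 yE; field; rewrite !lt0r_neq0.
  by apply: normr_div_mul_le; rewrite // ler0_norm; lra.
have -> : (Q + 1) / (2 * Q) - (x + y) / 2 / N = (Q - 1) / 2 / (Q * N).
  have -> : y = (N + 1) / Q by rewrite -yE mulfK // lt0r_neq0.
  by rewrite -[x]mulr1 xE; field; rewrite !lt0r_neq0.
by apply: normr_div_mul_le; rewrite // ger0_norm; lra.
Qed.
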